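(* Let $V = V_1 \oplus \dots \oplus V_{16}$, with $\gamma_i$, $\gamma$, $\lambda$ the data of AES as described in the context, and let $m = 8$. Then the following hold: (1) $0\gamma = 0$ and $\gamma^2 = 1$, the identity transformation. (2) There is an integer $r$ with $1 \le r < m/2$ such that for all $i$: - for all $0 \ne v \in V_i$, the image of the map $V_i \to V_i$, $x \mapsto (x+v)\gamma_i + x\gamma_i$, has size greater than $2^{m-r-1}$; and - there is no proper $\mathrm{GF}(2)$-subspace of $V_i$, invariant under $\gamma_i$, of codimension (in $V_i$) less than or equal to $2r$. (3) No sum of some of the $V_i$ (except $\{0\}$ and $V$) is invariant under $\lambda$.
   Context: Maps are written on the right and composed left to right. Description of AES used here. Let $\mathrm{GF}(2^8) = \mathrm{GF}(2)[X]/(X^8+X^4+X^3+X+1)$, let $\theta$ be the class of $X$, and identify a byte $(a_0,\dots,a_7)$ with $\sum_j a_j\theta^j$. The state space $V$ is the space of $4 \times 4$ arrays $(a_{i,j})_{0\le i,j\le 3}$ (row $i$, column $j$) with entries in $\mathrm{GF}(2^8)$, regarded as a $128$-dimensional vector space over $\mathrm{GF}(2)$; $V_1,\dots,V_{16}$ are the $16$ subspaces of arrays supported in a single given position, each identified with $\mathrm{GF}(2^8)$ (so each has dimension $m=8$ over $\mathrm{GF}(2)$). S-boxes: each $\gamma_i$ is the map $x \mapsto x^{2^8-2}$ on $\mathrm{GF}(2^8)$ (inversion on nonzero elements, with $0\mapsto 0$), and $(v_1+\dots+v_{16})\gamma = v_1\gamma_1 + \dots + v_{16}\gamma_{16}$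 for $v_i\in V_i$. The AES S-box is inversion followed by an affine map; the linear part of this affine map is moved into the mixing layer and its translation part is absorbed in the key addition. Thus the linear mixing layer is $\lambda = L\cdot\mathrm{ShiftRows}\cdot\mathrm{MixColumns}$ (applied in this order), where: - $L$ applies to each byte $(a_0,\dots,a_7)$ the invertible $\mathrm{GF}(2)$-linear map with output $(b_0,\dots,b_7)$, $b_j = a_j + a_{j+4}+a_{j+5}+a_{j+6}+a_{j+7}$, indices modulo $8$; - $\mathrm{ShiftRows}$ maps $(a_{i,j})$ to $(b_{i,j})$ with $b_{i,j} = a_{i,\,j+i}$, column index modulo $4$; - $\mathrm{MixColumns}$ multiplies each column (as a column vector) on the left by the circulant matrix over $\mathrm{GF}(2^8)$ with rows $(\theta,\theta+1,1,1)$, $(1,\theta,\theta+1,1)$, $(1,1,\theta,\theta+1)$, $(\theta+1,1,1,\theta)$. A subset $S$ is invariant under a map $f$ if $Sf \subseteq S$. *)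

(* Defs.v *)
From HB Require Import structures.
From mathcomp Require Import all_boot all_order all_algebra all_field.

Set Implicit Arguments.
Unset Strict Implicit.
Unset Printing Implicit Defensive.

Import GRing.Theory.
Local Open Scope ring_scope.

Definition aes_poly : {poly 'F_2} := 'X^8 + 'X^4 + 'X^3 + 'X + 1.

Lemma aes_poly_Poly :
  aes_poly = Poly [:: 1; 1; 0; 1; 1; 0; 0; 0; 1].
Proof.
by apply/polyP => i; rewrite coef_Poly !coefD !coefXn coefX coef1;
   do 9?[case: i => [|i] //=]; rewrite ?nth_nil ?addr0 ?add0r.
Qed.

Lemma size_aes_poly : size aes_poly = 9%N.
Proof. by rewrite aes_poly_Poly (PolyK (c := 0)). Qed.

Lemma aes_poly_monic : aes_poly \is monic.
Proof. by rewrite monicE lead_coefE size_aes_poly aes_poly_Poly coef_Poly. Qed.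

Lemma aes_poly_no_small_factor (q r : {poly 'F_2}) :
  q * r = aes_poly -> (1 < size q <= 5)%N -> False.
Proof.
move=> qr /andP[q_gt1 q_le5].
pose f (x : 'F_2) := x != 0.
have fD : {morph f : x y / x + y >-> x (+) y}.
  by do 2![case=> [[|[|?]] ?] //].
have fM : {morph f : x y / x * y >-> x && y}.
  by do 2![case=> [[|[|?]] ?] //].
have f0 : f 0 = false by [].
have r9 : (size r <= 9)%N.
  rewrite -size_aes_poly -qr.
  have rn0 : r != 0.
    apply/eqP=> r0; move: qr; rewrite r0 mulr0 => /esym/eqP.
    by rewrite -size_poly_eq0 size_aes_poly.
  rewrite size_mul -?size_poly_gt0 ?(ltnW q_gt1) ?size_poly_gt0 //.
  by case: (size q) q_gt1 => // n _; rewrite leq_addl.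
have E i : f (q * r)`_i = f aes_poly`_i by rewrite qr.
have qnc : [|| f q`_1, f q`_2, f q`_3 | f q`_4].
  apply: contraLR q_gt1; rewrite !negb_or !negbK -leqNgt.
  case/and4P=> /eqP h1 /eqP h2 /eqP h3 /eqP h4.
  apply/leq_sizeP=> -[|[|[|[|[|j]]]]] // _.
  by rewrite nth_default // (leq_trans q_le5).
have E9 : f (q * r)`_9 = false by rewrite qr nth_default ?size_aes_poly.
have E10 : f (q * r)`_10 = false by rewrite qr nth_default ?size_aes_poly.
have E11 : f (q * r)`_11 = false by rewrite qr nth_default ?size_aes_poly.
have E12 : f (q * r)`_12 = false by rewrite qr nth_default ?size_aes_poly.
have qb i : (5 <= i)%N -> f q`_i = false.
  by move=> hi; rewrite nth_default // (leq_trans q_le5).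
have rb i : (9 <= i)%N -> f r`_i = false.
  by move=> hi; rewrite nth_default // (leq_trans r9).
move: (E 0%N) (E 1%N) (E 2%N) (E 3%N) (E 4%N) (E 5%N) (E 6%N) (E 7%N) (E 8%N) E9 E10 E11 E12 qnc.
rewrite aes_poly_Poly !coef_Poly !coefM !big_ord_recl !big_ord0 /=.
rewrite /bump /= !(fD, fM, f0) !add1n ?addn0 ?subn0.
rewrite /subn /= ?[f q`_5]qb ?[f q`_6]qb ?[f q`_7]qb ?[f q`_8]qb ?[f q`_9]qb
  ?[f q`_10]qb ?[f q`_11]qb ?[f q`_12]qb ?[f r`_9]rb
  ?[f r`_10]rb ?[f r`_11]rb ?[f r`_12]rb //.
have -> : f 1 = true by [].
case: (f q`_0) => //=; case: (f q`_1); case: (f q`_2);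
case: (f q`_3); case: (f q`_4) => //=;
case: (f r`_0) => //=; case: (f r`_1) => //=; case: (f r`_2) => //=;
case: (f r`_3) => //=; case: (f r`_4) => //=; case: (f r`_5) => //=;
case: (f r`_6) => //=; case: (f r`_7) => //=; case: (f r`_8) => //=.
Qed.

Lemma aes_poly_irreducible : irreducible_poly aes_poly.
Proof.
split=> [|q q_neq1 q_dvd]; first by rewrite size_aes_poly.
have p0 : aes_poly != 0 by rewrite -size_poly_eq0 size_aes_poly.
have /dvdpP[r Er] := q_dvd.
have r0 : r != 0 by apply: contraNneq p0 => r0; rewrite Er r0 mul0r.
have q0 : q != 0 by apply: contraNneq p0 => q0; rewrite Er q0 mulr0.
have sz : (size r + size q = 10)%N.
  have := size_mul r0 q0; rewrite -Er size_aes_poly => /esym.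
  by move: (size r + size q)%N => [|n] //= ->.
have q_gt1 : (1 < size q)%N.
  by rewrite ltn_neqAle eq_sym q_neq1 size_poly_gt0.
have [q_le5|q_gt5] := leqP (size q) 5.
  by case: (@aes_poly_no_small_factor q r); rewrite 1?mulrC ?q_gt1.
have r_le5 : (size r <= 5)%N.
  rewrite leqNgt; apply/negP => r_gt5.
  by have := leq_add r_gt5 q_gt5; rewrite sz.
have [r_gt1|r_le1] := ltnP 1 (size r).
  by case: (@aes_poly_no_small_factor r q); rewrite ?r_gt1.
have r1 : size r = 1%N by apply/eqP; rewrite eqn_leq r_le1 size_poly_gt0.
rewrite -dvdp_size_eqp // size_aes_poly.
by move: sz; rewrite r1 add1n => -[->].
Qed.

Definition aes_poly_mi : monic_irreducible_poly aes_poly :=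
  (aes_poly_irreducible, aes_poly_monic).

Notation GF256 := {poly %/ aes_poly with aes_poly_mi}.

Definition theta : GF256 := in_qpoly aes_poly 'X.

Definition byte_of_bits (a : nat -> 'F_2) : GF256 :=
  \sum_(j < 8) a j *: theta ^+ j.

(* An element of GF256 is represented by its remainder modulo aes_poly, so its
   coordinates on the powers of theta are the coefficients of that remainder;
   see bitK and bit_byte_of_bits. *)
Definition bit (x : GF256) (j : nat) : 'F_2 := (polyn x)`_j.

Lemma polyn_byte_of_bits (a : nat -> 'F_2) :
  polyn (byte_of_bits a) = \poly_(j < 8) a j.
Proof.
have mkE := mk_monicE aes_poly_mi.
have -> : byte_of_bits a = in_qpoly aes_poly (\poly_(j < 8) a j).
  rewrite poly_def linear_sum; apply: eq_bigr => j _.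
  by rewrite linearZ /= rmorphXn.
by rewrite in_qpoly_small // mkE size_aes_poly ltnS size_poly.
Qed.

Lemma bitK (x : GF256) : byte_of_bits (bit x) = x.
Proof.
apply: val_inj; rewrite /= polyn_byte_of_bits; apply/polyP => i.
rewrite coef_poly; case: ltnP => // hi; rewrite nth_default //.
apply: leq_trans hi; rewrite -ltnS; apply: leq_trans (size_mk_monic x) _.
by rewrite (mk_monicE aes_poly_mi) size_aes_poly.
Qed.

Lemma bit_byte_of_bits (a : nat -> 'F_2) j :
  (j < 8)%N -> bit (byte_of_bits a) j = a j.
Proof. by move=> hj; rewrite /bit polyn_byte_of_bits coef_poly hj. Qed.

(* The pair (i, j) is the position in row i and column j. *)
Definition position : finType := ('I_4 * 'I_4)%type.

Definition state := {ffun position -> GF256}.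

Definition embed (p : position) (x : GF256) : state :=
  [ffun q => if q == p then x else 0].

Fact embed_is_linear p : linear (embed p).
Proof.
move=> k x y; apply/ffunP => q; rewrite !ffunE.
by case: eqP => // _; rewrite scaler0 addr0.
Qed.

HB.instance Definition _ p :=
  GRing.isLinear.Build 'F_2 GF256 state _ (embed p) (embed_is_linear p).

(* The arrays supported in position p (memVsubP); embed p identifies GF256 with
   this subspace. *)
Definition Vsub (p : position) : {vspace state} := limg (linfun (embed p)).

Lemma memVsubP (p : position) (a : state) :
  reflect (forall q, q != p -> a q = 0) (a \in Vsub p).
Proof.
apply: (iffP (memv_imgP)) => [[x _ ->] q /negPf qp|h].
  by rewrite lfunE /= ffunE qp.
exists (a p); rewrite ?memvf // lfunE /=; apply/ffunP => q; rewrite ffunE.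
by case: eqVneq => [->//|/h].
Qed.

Lemma dim_Vsub p : \dim (Vsub p) = 8%N.
Proof.
rewrite /Vsub limg_dim_eq.
  by rewrite dim_polyn (mk_monicE aes_poly_mi) size_aes_poly.
apply/eqP; rewrite capfv; apply/lker0P => x y.
by rewrite !lfunE /= => /ffunP/(_ p); rewrite !ffunE eqxx.
Qed.

Lemma sum_Vsub : (\sum_p Vsub p)%VS = fullv.
Proof.
apply/eqP; rewrite eqEsubv subvf; apply/subvP => a _.
have -> : a = \sum_p embed p (a p).
  apply/ffunP => q; rewrite sum_ffunE (bigD1 q) //= big1 => [|p pq].
    by rewrite ffunE eqxx addr0.
  by rewrite ffunE eq_sym (negPf pq).
apply: memv_sumr => p _; apply/memVsubP => q qp.
by rewrite ffunE (negPf qp).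
Qed.

Lemma directv_Vsub : directv (\sum_p Vsub p).
Proof.
apply/directv_sum_independent => v hv s0 p _.
apply/ffunP => q; have [->|qp] := eqVneq q p; last first.
  by move/memVsubP: (hv p isT) => ->; rewrite ?ffunE.
have /ffunP/(_ p) := s0; rewrite sum_ffunE (bigD1 p) //= big1 ?addr0 //.
by move=> k kp; move/memVsubP: (hv k isT) => ->; rewrite // eq_sym.
Qed.

Definition sbox (x : GF256) : GF256 := x ^+ (2 ^ 8 - 2)%N.

(* The map gamma_i, transported to Vsub p along embed p. *)
Definition gamma_at (p : position) (v : state) : state := embed p (sbox (v p)).

(* embed p (a p) is the component of a in Vsub p; see gamma_sum. *)
Definition gamma (a : state) : state := \sum_p gamma_at p (embed p (a p)).

Lemma gammaE (a : state) p : gamma a p = sbox (a p).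
Proof.
rewrite /gamma sum_ffunE (bigD1 p) //= big1 => [|q qp].
  by rewrite addr0 !ffunE !eqxx.
by rewrite ffunE eq_sym (negPf qp).
Qed.

Lemma gamma_sum (v : position -> state) :
  (forall p, v p \in Vsub p) ->
  gamma (\sum_p v p) = \sum_p gamma_at p (v p).
Proof.
move=> hv; apply: eq_bigr => p _; congr embed; congr sbox.
rewrite ffunE eqxx sum_ffunE (bigD1 p) //= big1 ?addr0 // => q qp.
by move/memVsubP: (hv q) => ->; rewrite // eq_sym.
Qed.

Definition L_byte (x : GF256) : GF256 :=
  let a j := bit x (j %% 8)%N in
  byte_of_bits
    (fun j => a j + a (j + 4)%N + a (j + 5)%N + a (j + 6)%N + a (j + 7)%N).

Definition L_layer (a : state) : state := [ffun p => L_byte (a p)].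

(* The addition is the one of 'I_4, i.e. modulo 4. *)
Definition ShiftRows (a : state) : state := [ffun p => a (p.1, p.2 + p.1)].

Definition mix_matrix : 'M[GF256]_4 :=
  \matrix_(i, j) nth 0 (nth [::]
    [:: [:: theta; theta + 1; 1; 1];
        [:: 1; theta; theta + 1; 1];
        [:: 1; 1; theta; theta + 1];
        [:: theta + 1; 1; 1; theta]] i) j.

Definition MixColumns (a : state) : state :=
  [ffun p => (mix_matrix *m \col_i a (i, p.2)) p.1 0].

Definition lambda (a : state) : state := MixColumns (ShiftRows (L_layer a)).

Definition invariant_under (f : state -> state) (S : {pred state}) : Prop :=
  {in S, forall x, f x \in S}.

(* Main.v *)
Require Import Defs.
From HB Require Import structures.
From mathcomp Require Import all_boot all_order all_algebra all_field.
From mathcomp Require Import ring.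
Import GRing.Theory.
Local Open Scope ring_scope.

(** In a field with 256 elements, x ^+ 254 is x^-1, with 0 sent to 0, so the
    S-box is field inversion, which is an involution ([sbox_inv]).

    Condition (2) holds with r = 1. For the derivative of inversion in a
    direction v != 0, away from 0 and - v one has
    (x + v)^-1 - x^-1 = - v / (x * (x + v)), and a value of x * (x + v) is taken
    by at most the two points x and - v - x. Hence the 254 remaining points
    have at least 127 > 2 ^ 6 images ([card_inv_derivative]). As for subspaces
    of codimension at most 2, Hua's identity
    a - (a^-1 + (b^-1 - a)^-1)^-1 = a * b * a shows that an additive subgroup S
    closed under inversion is stable under multiplication by a ^+ 2 for a in S.
    If #|S| ^ 2 exceeds the order of the field, then pigeonhole makes every
    element z a quotient of two elements of S, so S is stable under
    multiplication by z ^+ 2. In characteristic 2 every element is a square,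
    and S is the whole field ([large_inv_closed_full]). This excludes every
    proper invariant subspace of dimension at least 5. The field GF(16) shows
    that dimension 4 does occur, so the argument is sharp.

    For (3), all coefficients of the MixColumns matrix are nonzero, so a state
    supported at row i and column j whose byte is not killed by L is mapped to a
    state that is nonzero throughout column j - i ([lambda_embed_neq0]). A sum of some
    Vsub p that is invariant and contains one position thus contains a full
    column, and the four positions of that column lead to four different
    columns, hence to all positions. *)

(** * Derivatives of inversion *)

Lemma card_le_imset_fiber2 (T T' : finType) (A : {set T}) (f : T -> T')
    (s : T -> T) :
  {in A &, forall x y, f x = f y -> y = x \/ y = s x} ->
  (#|A| <= 2 * #|f @: A|)%N.
Proof.
(* Count A fibre by fibre. *)
move=> fib; rewrite -sum1_card (partition_big_imset f) /= mulnC -sum_nat_const.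
apply: leq_sum => _ /imsetP[x xA ->].
rewrite sum1_card (@leq_trans #|[set x; s x]|) //; last first.
  by rewrite cards2; case: eqP.
apply/subset_leq_card/subsetP => y /andP[yA /eqP fxy]; rewrite !inE.
by case: (fib x y) => // ->; rewrite eqxx ?orbT.
Qed.

(** The term 2 pays for the points 0 and - v, where one of the two inverses is
    0^-1 = 0 and the quotient formula for the difference fails. *)
Lemma card_inv_derivative (F : finFieldType) (v : F) : v != 0 ->
  (#|F| <= 2 + 2 * #|[set ((x + v)^-1 - x^-1)%R | x in F]|)%N.
Proof.
move=> v0; pose D x := (x + v)^-1 - x^-1; pose A := ~: [set 0; - v].
have DE x : x \in A -> D x = - v / (x * (x + v)) /\ x * (x + v) != 0.
  rewrite !inE negb_or => /andP[x0 xv].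
  have xv0 : x + v != 0 by rewrite addr_eq0.
  split; last by rewrite mulf_neq0.
  by rewrite /D; field; rewrite ?x0 ?xv0.
have fib : {in A &, forall x y, D x = D y -> y = x \/ y = - v - x}.
  move=> x y /DE[-> nx] /DE[-> ny].
  move/(mulfI (_ : - v != 0)); rewrite oppr_eq0 => /(_ v0)/invr_inj exy.
  have : (y - x) * (y - (- v - x)) == 0.
    by apply/eqP; transitivity (y * (y + v) - x * (x + v)); [ring | rewrite exy subrr].
  by rewrite mulf_eq0 !subr_eq0 => /orP[]/eqP ->; [left | right].
rewrite -(cardsC [set 0; - v]) leq_add //; first by rewrite cards2; case: eqP.
apply: leq_trans (card_le_imset_fiber2 _ _ _ D _ fib) _.
by rewrite leq_mul2l /= subset_leq_card // imsetS //; apply/subsetP.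
Qed.

(** * Additive subgroups closed under inversion *)

(** Hua's identity expresses a * b * a by additions and inversions alone; its
    denominators vanish only when a = 0, b = 0 or a * b = 1, and in these cases
    a ^+ 2 * b is 0 or a. *)
Lemma sqr_mul_inv_closed (F : fieldType) (S : zmodClosed F) :
  {in S, forall x, x^-1 \in S} -> {in S &, forall a b, a ^+ 2 * b \in S}.
Proof.
move=> SV a b aS bS.
have [->|a0] := eqVneq a 0; first by rewrite expr0n mul0r rpred0.
have [->|b0] := eqVneq b 0; first by rewrite mulr0 rpred0.
have [ab1|ab1] := eqVneq (a * b) 1; first by rewrite expr2 -mulrA ab1 mulr1.
have -> : a ^+ 2 * b = a - (a^-1 + (b^-1 - a)^-1)^-1.
  have n1 : 1 - a * b != 0 by rewrite subr_eq0 eq_sym.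
  have n2 : b^-1 - a = (1 - a * b) / b by field.
  by rewrite n2 invf_div; field; rewrite n1 a0 mulrC subrK oner_neq0.
by rewrite rpredB ?SV // rpredD ?SV // rpredB ?SV.
Qed.

(** The cardinality bound cannot be relaxed: the subfield with q elements of a
    field with q ^ 2 elements is closed under inversion. *)
Lemma large_inv_closed_full (F : finFieldType) (S : zmodClosed F) :
    2 \in [pchar F] -> {in S, forall x, x^-1 \in S} ->
    (#|F| < #|S| ^ 2)%N -> forall x, x \in S.
Proof.
move=> F2 SV bigS.
(* Two pairs with the same value of a - z * b differ by a pair whose quotient
   is z. *)
have ratio z : exists a b, [/\ a \in S, b \in S, b != 0 & z = a / b].
  pose h (p : F * F) := p.1 - z * p.2.
  have /dinjectivePn[[a b] /setXP /= [aS bS] [[c d]]] :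
      ~~ dinjectiveb h (setX [set x in S] [set x in S]).
    apply: contraL bigS => /dinjectiveP/leq_card_in.
    by rewrite cardsX cardsE -leqNgt mulnn.
  rewrite !inE /= in aS bS * => /and3P[neq cS dS].
  rewrite /h /= => e.
  have bd : b - d != 0.
    apply: contraNneq neq => /subr0_eq bd; move: e; rewrite bd => /addIr ->.
    by rewrite eqxx.
  exists (a - c), (b - d); rewrite !rpredB //; split=> //.
  have {}e : a - c = z * (b - d).
    by transitivity ((a - z * b) - c + z * b); [ring | rewrite e; ring].
  by rewrite e mulfK.
(* Write z = a / b. Since b^-1 is in S too, multiplying by b^-1 ^+ 2 and then
   by a ^+ 2 stays in S. *)
have mulS z y : y \in S -> z ^+ 2 * y \in S.
  move=> yS; have [a [b [aS bS b0 ->]]] := ratio z.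
  have -> : (a / b) ^+ 2 * y = a ^+ 2 * (b^-1 ^+ 2 * y) by ring.
  by rewrite !(sqr_mul_inv_closed _ _ SV) ?SV.
have [w wS w0] : exists2 w, w \in S & w != 0.
  by have [a [b [_ bS b0 _]]] := ratio 0; exists b.
(* Frobenius is bijective, so x / w is a square. *)
move=> x.
have /codomP[z ez] := injF_onto (fmorph_inj (pFrobenius_aut F2)) (x / w).
by rewrite -[x](divfK w0) ez; apply: mulS.
Qed.

(** * The S-boxes *)

Lemma card_GF256 : #|{: GF256}| = 256%N.
Proof. by rewrite card_qfpoly card_Fp // size_aes_poly. Qed.

Lemma pchar_GF256 : 2 \in [pchar GF256].
Proof. by rewrite pchar_lalg pchar_Fp. Qed.

Lemma sbox_inv x : sbox x = x^-1.
Proof.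
have [->|x0] := eqVneq x 0; first by rewrite /sbox expr0n invr0.
apply: (mulfI (expf_neq0 2 x0)); rewrite /sbox -exprD addnC subnK //.
have := expf_card x; rewrite card_GF256 => ->.
by rewrite expr2 -mulrA divff // mulr1.
Qed.

Lemma embed_inj p : injective (embed p).
Proof. by move=> x y /ffunP/(_ p); rewrite !ffunE eqxx. Qed.

Lemma VsubE p a : a \in Vsub p -> a = embed p (a p).
Proof.
move=> /memVsubP h; apply/ffunP => q; rewrite ffunE.
by case: eqVneq => [->|/h].
Qed.

Lemma embed_Vsub p x : embed p x \in Vsub p.
Proof. by apply/memVsubP => q /negPf qp; rewrite ffunE qp. Qed.

Lemma gamma_at_derivative_gt p (v : state) : v \in Vsub p -> v != 0 ->
  (64 < #|[set (gamma_at p (x + v) + gamma_at p x)%R | x : state in Vsub p]|)%N.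
Proof.
(* It suffices to count the values at position p; the sum of the two images
   is a difference, as the characteristic is 2. *)
move=> vV v0; set B := imset _ _.
have vp0 : v p != 0.
  by apply: contraNneq v0 => vp; rewrite (VsubE _ _ vV) vp linear0.
have := card_inv_derivative _ _ vp0; rewrite card_GF256; set A := imset _ _.
have AB : (#|A| <= #|B|)%N.
  apply: leq_trans (leq_imset_card (fun a : state => a p) B).
  apply/subset_leq_card/subsetP => _ /imsetP[x _ ->].
  apply/imsetP; exists (gamma_at p (embed p x + v) + gamma_at p (embed p x)).
    by apply/imsetP; exists (embed p x); rewrite ?embed_Vsub.
  by rewrite !ffunE eqxx !sbox_inv (oppr_pchar2 pchar_GF256).
move=> h; have {h AB} : (256 <= 2 + 2 * #|B|)%N.
  by apply: leq_trans h _; rewrite leq_add2l leq_mul2l.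
by rewrite (leq_add2l 2 254) (leq_mul2l 2 127) /=; apply: leq_trans.
Qed.

(** Under [embed p], the subspace U becomes an additive subgroup of the field
    closed under inversion, with at least 32 elements, and 32 ^ 2 > 256. *)
Lemma gamma_at_no_invariant p (U : {vspace state}) :
    (U <= Vsub p)%VS -> invariant_under (gamma_at p) (mem U) ->
    (4 < \dim U)%N -> U = Vsub p.
Proof.
move=> UV Uinv dimU.
pose S := (linfun (embed p) @^-1: U)%VS.
have memS x : (x \in S) = (embed p x \in U) by rewrite -memv_preim lfunE.
have US : embed p @: S = [set a in U].
  apply/setP => a; rewrite inE; apply/imsetP/idP => [[x xS ->]|aU].
    by rewrite -memS.
  by exists (a p); rewrite ?memS -?VsubE // (subvP UV).
have cardS : #|S| = (2 ^ \dim U)%N.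
  by rewrite -(card_imset _ (embed_inj p)) US cardsE card_vspace card_Fp.
have SV : {in S, forall x, x^-1 \in S}.
  move=> x; rewrite !memS => /Uinv; rewrite /gamma_at ffunE eqxx sbox_inv.
  by [].
have Sfull : forall x, x \in S.
  apply: (large_inv_closed_full _ _ pchar_GF256 SV).
  rewrite card_GF256 cardS -expnM.
  by rewrite -[256%N]/(2 ^ (4 * 2))%N ltn_exp2l // ltn_pmul2r.
apply/eqP; rewrite eqEsubv UV; apply/subvP => a /VsubE ->.
by rewrite -memS.
Qed.

(** * The mixing layer *)

Lemma theta_neq0 : theta != 0.
Proof.
apply/eqP => /(congr1 (fun x : GF256 => polyn x)); rewrite in_qpoly_small.
  by move/eqP; rewrite /= polyX_eq0.
by rewrite (mk_monicE aes_poly_mi) size_aes_poly size_polyX.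
Qed.

Lemma theta_add1_neq0 : theta + 1 != 0.
Proof.
apply/eqP => /(congr1 (fun x : GF256 => polyn x)).
rewrite /theta -(rmorph1 (in_qpoly aes_poly)) -rmorphD in_qpoly_small.
  by move/eqP; rewrite -size_poly_eq0 size_XaddC.
by rewrite (mk_monicE aes_poly_mi) size_aes_poly size_XaddC.
Qed.

Lemma mix_matrix_neq0 i j : mix_matrix i j != 0.
Proof.
rewrite mxE; case: i j => [[|[|[|[|i]]]] ?] // [[|[|[|[|j]]]] ?] //=;
  by rewrite ?oner_neq0 ?theta_neq0 ?theta_add1_neq0.
Qed.

Lemma L_byte0 : L_byte 0 = 0.
Proof.
rewrite /L_byte /byte_of_bits big1 // => j _.
by rewrite /bit !coef0 !addr0 scale0r.
Qed.

(** Provides a state supported in one position whose byte survives L_layer; of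
    the five bits that add up to bit 0 of the image, only bit 0 is set. *)
Lemma L_byte1 : L_byte 1 != 0.
Proof.
apply/eqP => /(congr1 (fun x => bit x 0)); rewrite bit_byte_of_bits //.
by rewrite /bit /= !coefC !addr0 => /eqP; rewrite oner_eq0.
Qed.

(** L_layer maps zero bytes to zero and so keeps the position, ShiftRows
    sends (i, j) to (i, j - i), and each entry of the column multiplied by
    [mix_matrix] then has a single nonzero summand. *)
Lemma lambda_embed_neq0 (p : position) (k : 'I_4) (x : GF256) :
  L_byte x != 0 -> lambda (embed p x) (k, p.2 - p.1) != 0.
Proof.
move=> Lx; rewrite ffunE mxE (bigD1 p.1) //= big1 => [|i ip].
  rewrite addr0 mulf_neq0 ?mix_matrix_neq0 // mxE !ffunE /= subrK.
  by rewrite -surjective_pairing eqxx.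
by rewrite mxE !ffunE /= -pair_eqE /= (negPf ip) L_byte0 mulr0.
Qed.

Lemma mem_sum_Vsub (I : {set position}) (a : state) :
  reflect (forall q, q \notin I -> a q = 0) (a \in \sum_(p in I) Vsub p)%VS.
Proof.
apply: (iffP idP) => [/memv_sumP[v vV ->] q qI|h].
  rewrite sum_ffunE big1 // => p pI; move/memVsubP: (vV p pI) => -> //.
  by apply: contraNneq qI => ->.
have -> : a = \sum_(p in I) embed p (a p).
  apply/ffunP => q; rewrite sum_ffunE; have [qI|qI] := boolP (q \in I).
    rewrite (bigD1 q) //= big1 => [|p /andP[_ pq]]; rewrite ffunE ?eqxx ?addr0 //.
    by rewrite eq_sym (negPf pq).
  rewrite big1 ?h // => p pI; rewrite ffunE; case: eqP qI => // ->.
  by rewrite pI.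
by apply: memv_sumr => p _; apply: embed_Vsub.
Qed.

Theorem lemma5p2 :
  let m := 8%N in
  [/\ gamma 0 = 0 /\ gamma \o gamma =1 id,
      exists r : nat,
        [/\ (1 <= r)%N, (r < m %/ 2)%N &
          forall i : position,
            (forall v : state, v \in Vsub i -> v != 0 ->
               (2 ^ (m - r - 1) <
                 #|[set (gamma_at i (x + v) + gamma_at i x)%R | x : state in Vsub i]|)%N)
            /\
            ~ (exists U : {vspace state},
                 [/\ (U <= Vsub i)%VS, U <> Vsub i,
                     invariant_under (gamma_at i) (mem U) &
                     (\dim (Vsub i) - \dim U <= 2 * r)%N])] &
      forall I : {set position},
        let W := (\sum_(i in I) Vsub i)%VS in
        W <> 0%VS -> W <> fullv -> ~ invariant_under lambda (mem W)].
Proof.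
split.
- split; last by move=> a; apply/ffunP => p; rewrite /= !gammaE !sbox_inv invrK.
  by apply/ffunP => p; rewrite gammaE sbox_inv !ffunE invr0.
- exists 1%N; split=> // i; split; first exact: gamma_at_derivative_gt.
  case=> U [UV UneV Uinv]; rewrite dim_Vsub => codimU.
  apply: UneV; apply: gamma_at_no_invariant => //.
  by rewrite leqNgt; apply: contraL codimU; case: (\dim U) => [|[|[|[|[|]]]]].
move=> I W W0 Wfull Winv; apply: Wfull.
(* One position of I puts a whole column into I. *)
have step p k : p \in I -> (k, p.2 - p.1) \in I.
  move=> pI; have /Winv : embed p 1 \in W.
    by apply/mem_sum_Vsub => q qI; rewrite ffunE; case: eqP qI => // ->; rewrite pI.
  move/mem_sum_Vsub => h; apply: contraT => /h/eqP.
  by rewrite (negPf (lambda_embed_neq0 _ _ _ L_byte1)).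
have [p pI] : exists p, p \in I.
  by apply/set0Pn/eqP => I0; apply: W0; rewrite /W I0 big_set0.
suff IT : I = setT by rewrite /W IT -sum_Vsub; apply: eq_bigl => q; rewrite inE.
(* The column p.2 - p.1 is in I. Its entry in row p.2 - p.1 - j is sent by the
   shift to column j. *)
apply/setP => -[i j]; rewrite inE.
by have := step _ i (step p (p.2 - p.1 - j) pI); rewrite subKr.
Qed.
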